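(* Consider the rational generalized Nash equilibrium problem and its KKT set $\mathcal K\subseteq\mathbb R^n$ described in the context. Assume $\mathcal K$ is a finite set. Then for every triple $(u,i,v_i)$ with $u=(u_1,\dots,u_N)\in\mathcal K$, $i\in[N]$ and $v_i\in X_i(u_{-i})$, there exists a rational vector-valued function $p_i$ in $x=(x_1,\dots,x_N)$ (a feasible extension of $v_i$ at $u$) such that $$p_i(u)=v_i,\qquad p_i(x)\in X_i(x_{-i})\ \text{ for all } x\in\mathcal K.$$ Moreover, such $p_i$ can be chosen as a polynomial vector function.
   Context: There are $N$ players; $[N]=\{1,\dots,N\}$. Player $i$ has strategy $x_i\in\mathbb R^{n_i}$; $n=n_1+\cdots+n_N$, $x=(x_1,\dots,x_N)\in\mathbb R^n$, $x_{-i}=(x_1,\dots,x_{i-1},x_{i+1},\dots,x_N)$, and we also write $x=(x_i,x_{-i})$. Given $x_{-i}$, player $i$ solves $$\mathrm F_i(x_{-i}):\quad \min_{x_i\in\mathbb R^{n_i}} f_i(x_i,x_{-i})\quad\text{s.t. } x_i\in X_i(x_{-i}),$$ $$X_i(x_{-i})=\{x_i: g_{i,j}(x)=0\ (j\in\mathcal I^{(i)}_0),\ g_{i,j}(x)\ge0\ (j\in\mathcal I^{(i)}_1),\ g_{i,j}(x)>0\ (j\in\mathcal I^{(i)}_2)\},$$ with finite, possibly empty, disjoint label sets. All $f_i,g_{i,j}$ are real rational functions in $x$, with denominators positive on the feasible sets. Let $X=\{x: x_i\in X_i(x_{-i}),\ i=1,\dots,N\}$. $(x_i,\lambda_i)$,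 with $\lambda_i=(\lambda_{i,j})_{j\in\mathcal I^{(i)}_0\cup\mathcal I^{(i)}_1}$ a real vector, is a critical pair of $\mathrm F_i(x_{-i})$ if $x_i\in X_i(x_{-i})$, $\nabla_{x_i}f_i(x)=\sum_{j\in\mathcal I^{(i)}_0\cup\mathcal I^{(i)}_1}\lambda_{i,j}\nabla_{x_i}g_{i,j}(x)$, $\lambda_{i,j}g_{i,j}(x)=0$ for all $j\in \mathcal I^{(i)}_0\cup\mathcal I^{(i)}_1$, and $\lambda_{i,j}\ge0$ for $j\in\mathcal I^{(i)}_1$. It is supposed that for each $i$ there are rational functions $\tau_{i,j}$ in $x$ ($j\in\mathcal I^{(i)}_0\cup\mathcal I^{(i)}_1$), with denominators positive on $X$, such that $\lambda_{i,j}=\tau_{i,j}(x)$ for each critical pair $(x_i,\lambda_i)$ of $\mathrm F_i(x_{-i})$. The KKT set is $$\mathcal K=\Big\{x\in X:\ \nabla_{x_i}f_i(x)=\sum_{j\in\mathcal I^{(i)}_0\cup\mathcal I^{(i)}_1}\tau_{i,j}(x)\nabla_{x_i}g_{i,j}(x)\ (i\in[N]),\ \tau_{i,j}(x)g_{i,j}(x)=0,\ \tau_{i,j}(x)\ge0\ (i\in[N],j\in\mathcal I^{(i)}_1)\Big\}.$$ *)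

(* Defs.v *)
From HB Require Import structures.
From mathcomp Require Import all_boot all_order all_algebra.
From mathcomp Require Import all_classical all_reals all_analysis.
From mathcomp Require Import -(notations) mpoly.
Set Implicit Arguments.
Unset Strict Implicit.
Unset Printing Implicit Defensive.
Import Order.TTheory GRing.Theory Num.Theory.
Import numFieldNormedType.Exports.
Local Open Scope classical_set_scope.
Local Open Scope ring_scope.

(* The denominator is part of the data, since the problem constrains the sign
   of the denominators; no coprimality is required. *)
Record ratfun (R : realType) (m : nat) := RatFun {
  rnum : mpoly.mpoly m R;
  rden : mpoly.mpoly m R;
  rden_neq0 : rden != 0
}.

Definition peval (R : realType) (m : nat) (p : mpoly.mpoly m R)
    (x : 'rV[R]_m) : R :=
  mpoly.meval (fun k => x ord0 k) p.

(* By the convention a / 0 = 0, this value is only meaningful where [rdefined]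
   holds. *)
Definition reval (R : realType) (m : nat) (f : ratfun R m) (x : 'rV[R]_m) : R :=
  peval (rnum f) x / peval (rden f) x.

Definition rdefined (R : realType) (m : nat) (f : ratfun R m)
    (x : 'rV[R]_m) : Prop :=
  peval (rden f) x != 0.

Definition rden_pos (R : realType) (m : nat) (f : ratfun R m)
    (x : 'rV[R]_m) : Prop :=
  0 < peval (rden f) x.

Definition ratfun_of_poly (R : realType) (m : nat) (p : mpoly.mpoly m R) :
    ratfun R m :=
  RatFun p (oner_neq0 _).

(* The labels of player [i] live in a finite type [label i]; those outside
   eqs i, ges i and gts i (constraints g = 0, g >= 0, g > 0) are unused. *)
Record rgnep (R : realType) (N : nat) (dim : 'I_N -> nat) := RGNEP {
  label : 'I_N -> finType;
  eqs : forall i, {set label i};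
  ges : forall i, {set label i};
  gts : forall i, {set label i};
  eqs_ges_disjoint : forall i, [disjoint eqs i & ges i]%B;
  eqs_gts_disjoint : forall i, [disjoint eqs i & gts i]%B;
  ges_gts_disjoint : forall i, [disjoint ges i & gts i]%B;
  obj : 'I_N -> ratfun R (\sum_i dim i)%N;
  con : forall i, label i -> ratfun R (\sum_i dim i)%N
}.

Section Game.
Variables (R : realType) (N : nat) (dim : 'I_N -> nat) (G : rgnep R dim).
Local Notation n := (\sum_i dim i)%N.

Definition strat (i : 'I_N) (x : 'rV[R]_n) : 'rV[R]_(dim i) := submxrow x i.

(* The profile (y, x_{-i}); it does not depend on [strat i x]. *)
Definition deviate (x : 'rV[R]_n) (i : 'I_N) (y : 'rV[R]_(dim i)) : 'rV[R]_n :=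
  \mxrow_(j < N) dfwith (fun k => strat k x) i y j.

Definition all_labels (i : 'I_N) : {set label G i} :=
  eqs G i :|: ges G i :|: gts G i.
Definition mult_labels (i : 'I_N) : {set label G i} := eqs G i :|: ges G i.

(* A point where some constraint function is undefined does not satisfy the
   constraints; this clause excludes the points made feasible by a / 0 = 0. *)
Definition satisfies (i : 'I_N) (x : 'rV[R]_n) : Prop :=
  [/\ forall j, j \in all_labels i -> rdefined (con j) x,
      forall j, j \in eqs G i -> reval (con j) x = 0,
      forall j, j \in ges G i -> 0 <= reval (con j) x
    & forall j, j \in gts G i -> 0 < reval (con j) x].

(* X_i(x_{-i}), as a function of the full profile [x]. *)
Definition feasible_set (i : 'I_N) (x : 'rV[R]_n) : set 'rV[R]_(dim i) :=
  [set y | satisfies i (deviate x y)].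
Arguments feasible_set : clear implicits.

Definition feasible_profiles : set 'rV[R]_n :=
  [set x | forall i, feasible_set i x (strat i x)].

Definition grad (i : 'I_N) (F : 'rV[R]_n -> R) (x : 'rV[R]_n) :
    'rV[R]_(dim i) :=
  \row_(k < dim i) 'D_(delta_mx ord0 (tagnat.Rank i k)) F x.

(* [(strat i x, lam)] is a critical pair of F_i(x_{-i}); only the values of
   [lam] on [mult_labels i] matter. *)
Definition critical_pair (i : 'I_N) (x : 'rV[R]_n) (lam : label G i -> R) :
    Prop :=
  [/\ feasible_set i x (strat i x),
      grad i (reval (obj G i)) x =
        \sum_(j in mult_labels i) lam j *: grad i (reval (con j)) x,
      forall j, j \in mult_labels i -> lam j * reval (con j) x = 0
    & forall j, j \in ges G i -> 0 <= lam j].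

(* Denominators are positive at every (x_i, x_{-i}) with x_i in X_i(x_{-i}). *)
Definition data_den_pos : Prop :=
  forall (i : 'I_N) (x : 'rV[R]_n), feasible_set i x (strat i x) ->
    rden_pos (obj G i) x /\
    (forall j, j \in all_labels i -> rden_pos (con j) x).

Definition multiplier_expr (tau : forall i, label G i -> ratfun R n) : Prop :=
  (forall i (j : label G i) (x : 'rV[R]_n),
     j \in mult_labels i -> feasible_profiles x -> rden_pos (tau i j) x) /\
  (forall i (x : 'rV[R]_n) (lam : label G i -> R), critical_pair x lam ->
     forall j, j \in mult_labels i -> lam j = reval (tau i j) x).

Definition KKT_set (tau : forall i, label G i -> ratfun R n) : set 'rV[R]_n :=
  [set x | [/\ feasible_profiles x,
      forall i, grad i (reval (obj G i)) x =
        \sum_(j in mult_labels i)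
          reval (tau i j) x *: grad i (reval (con j)) x
    & forall i (j : label G i), j \in ges G i ->
        reval (tau i j) x * reval (con j) x = 0 /\ 0 <= reval (tau i j) x]].

Definition feasible_extension (K : set 'rV[R]_n) (u : 'rV[R]_n) (i : 'I_N)
    (v : 'rV[R]_(dim i)) (p : 'I_(dim i) -> ratfun R n) : Prop :=
  [/\ forall x k, K x -> rdefined (p k) x,
      \row_k reval (p k) u = v
    & forall x, K x -> feasible_set i x (\row_k reval (p k) x)].

End Game.

Arguments feasible_set {R N dim} G i x _.

(* Main.v *)
(* Since K is finite and polynomials separate points, a polynomial vector p_i can
   take prescribed values on K.  Prescribing v_i at u and x_i at every other
   x in K gives a feasible extension, because every x in K is feasible. *)
Require Import Defs.
From mathcomp Require Import all_boot all_order all_algebra.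
From mathcomp Require Import all_classical all_reals all_analysis.
From mathcomp Require Import -(notations) mpoly.
Import Order.TTheory GRing.Theory Num.Theory.
Local Open Scope classical_set_scope.
Local Open Scope ring_scope.

(** The squared Euclidean distance to [y] works: a sum of real squares vanishes only when every term
    does. *)
Lemma poly_vanishing_only_at (R : realType) (m : nat) (y : 'rV[R]_m) :
  exists q : mpoly.mpoly m R, forall x, (peval q x == 0) = (x == y).
Proof.
exists (\sum_(k < m) (mpolyX R (mnm1 k) - mpolyC m (y ord0 k)) ^+ 2) => x.
rewrite /peval raddf_sum /= psumr_eq0 => [|k _]; last first.
  by rewrite rmorphXn sqr_ge0.
apply/allP/eqP => [q0|-> k _]; last first.
  by rewrite rmorphXn rmorphB /= mevalXU mevalC subrr expr0n.
apply/rowP => k; have := q0 k (mem_index_enum k).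
by rewrite rmorphXn rmorphB /= mevalXU mevalC sqrf_eq0 subr_eq0 => /eqP.
Qed.

(** Multiply, over the points of [s], polynomials that each vanish at that point alone. *)
Lemma poly_vanishing_exactly_on (R : realType) (m : nat)
    (s : seq 'rV[R]_m) :
  exists q : mpoly.mpoly m R, forall x, (peval q x == 0) = (x \in s).
Proof.
elim: s => [|y s [q qE]].
  by exists 1 => x; rewrite /peval rmorph1 oner_eq0.
have [r rE] := @poly_vanishing_only_at R m y.
exists (r * q) => x.
by rewrite in_cons -rE -qE /peval rmorphM mulf_eq0.
Qed.

(** Newton-style induction: a new point is fitted by a correction that vanishes on the earlier
    ones. *)
Lemma poly_interpolation (R : realType) (m : nat) (s : seq 'rV[R]_m)
    (h : 'rV[R]_m -> R) :
  exists q : mpoly.mpoly m R, forall x, x \in s -> peval q x = h x.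
Proof.
elim: s => [|y s [q qE]]; first by exists 0.
have [ys|ys] := boolP (y \in s).
  by exists q => x; rewrite in_cons => /predU1P[->|]; exact: qE.
have [z zE] := @poly_vanishing_exactly_on R m s.
(* The coefficient makes the value at [y] equal to [h y]; the division is genuine, since [y] outside
   [s] gives [peval z y != 0]. *)
exists (q + mpolyC m ((h y - peval q y) / peval z y) * z) => x.
rewrite /peval rmorphD rmorphM /= mevalC -!/(peval _ _) in_cons.
have [->|_ /= xs] := eqVneq x y; first by rewrite divfK ?zE// addrC subrK.
by move: (xs); rewrite -zE => /eqP ->; rewrite mulr0 addr0 qE.
Qed.

Lemma reval_ratfun_of_poly (R : realType) (m : nat) (q : mpoly.mpoly m R)
    (x : 'rV[R]_m) : reval (ratfun_of_poly q) x = peval q x.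
Proof. by rewrite /reval /peval rmorph1 divr1. Qed.

Theorem theorem4p2 (R : realType) (N : nat) (dim : 'I_N -> nat)
  (G : rgnep R dim)
  (hden : data_den_pos G)
  (tau : forall i : 'I_N, label G i -> ratfun R (\sum_i dim i)%N)
  (htau : multiplier_expr tau)
  (hfin : finite_set (KKT_set tau))
  (u : 'rV[R]_(\sum_i dim i)%N) (i : 'I_N) (v : 'rV[R]_(dim i))
  (hu : KKT_set tau u) (hv : feasible_set G i u v) :
  (exists p : 'I_(dim i) -> ratfun R (\sum_i dim i)%N,
     feasible_extension G (KKT_set tau) u v p) /\
  (exists q : 'I_(dim i) -> mpoly.mpoly (\sum_i dim i)%N R,
     feasible_extension G (KKT_set tau) u v (fun k => ratfun_of_poly (q k))).
Proof.
(* A polynomial is a rational function with denominator 1, so the second claim yields the first. *)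
suff: exists q : 'I_(dim i) -> mpoly.mpoly (\sum_i dim i)%N R,
    feasible_extension G (KKT_set tau) u v (fun k => ratfun_of_poly (q k)).
  by move=> [q qP]; split; [exists (fun k => ratfun_of_poly (q k)) | exists q].
have /finite_seqP[s KE] := hfin.
pose w x := if x == u then v else strat i x.
(* Each coordinate of the target [w] is interpolated separately. *)
have [q qE] := choice (fun k => @poly_interpolation R _ s (fun x => w x ord0 k)).
have qw x : KKT_set tau x -> \row_k reval (ratfun_of_poly (q k)) x = w x.
  move=> Kx; apply/rowP => k; rewrite mxE reval_ratfun_of_poly qE//.
  by move: Kx; rewrite KE.
exists q; split.
- by move=> x k _; rewrite /rdefined /peval rmorph1 oner_eq0.
- by rewrite qw// /w eqxx.
(* At [u] this is [hv]; elsewhere it is the feasibility clause of [KKT_set]. *)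
- move=> x Kx; rewrite qw// /w; case: eqP => [->//|_].
  by have [feas _ _] := Kx; exact: feas.
Qed.
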